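(* Let $G$ be a strongly topological gyrogroup with a symmetric neighborhood base $\mathscr U$ at $0$ and let $H$ be a locally compact metrizable admissible subgyrogroup of $G$ generated from $\mathscr U$. If the quotient space $G/H$ is $k$-semistratifiable, then the space $G$ is locally $k$-semistratifiable.
   Context: All topological spaces are assumed to be Hausdorff. A gyrogroup is a set $G$ with a binary operation $\oplus$ such that: (G1) there is a unique identity element $0\in G$ with $0\oplus a=a=a\oplus 0$ for all $a\in G$; (G2) for each $x\in G$ there is a unique inverse $\ominus x\in G$ with $\ominus x\oplus x=0=x\oplus(\ominus x)$; (G3) for all $x,y\in G$ there is an automorphism $\mathrm{gyr}[x,y]$ of $(G,\oplus)$ with $x\oplus(y\oplus z)=(x\oplus y)\oplus \mathrm{gyr}[x,y](z)$ for all $z\in G$; (G4) $\mathrm{gyr}[x\oplus y,y]=\mathrm{gyr}[x,y]$ for all $x,y\in G$. A topological gyrogroup is a gyrogroup with a topology such that $\oplus:G\times G\to G$ is jointly continuous and $x\mapsto\ominus x$ is continuous. A strongly topological gyrogroup with a symmetric neighborhood base $\mathscr U$ at $0$ is a topological gyrogroup $G$ together with a neighborhood base $\mathscr U$ of $0$ such that for every $U\in\mathscr U$: $\ominus U=U$ and $\mathrm{gyr}[x,y](U)=U$ for all $x,y\in G$. A subgyrogroup of $G$ is a nonempty subset $H$ with $\ominus a\in H$ and $a\oplus b\in H$ for all $a,b\in H$; it is an $L$-subgyrogroup if moreover $\mathrm{gyr}[a,h](H)=H$ for all $a\in G$, $h\in H$. A subgyrogroup $H$ of $G$ is an admissible subgyrogroup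 generated from $\mathscr U$ if there is a sequence $\{U_n:n\in\omega\}$ of open symmetric neighborhoods of $0$ with each $U_n\in\mathscr U$, $U_{n+1}\oplus(U_{n+1}\oplus U_{n+1})\subset U_n$ for each $n\in\omega$, and $H=\bigcap_{n\in\omega}U_n$. Such an $H$ is known to be a closed $L$-subgyrogroup of $G$. For an $L$-subgyrogroup $H$, the set $G/H=\{a\oplus H:a\in G\}$ is a partition of $G$; it carries the quotient topology with respect to $\pi:G\to G/H$, $\pi(a)=a\oplus H$ (i.e. $O\subset G/H$ is open iff $\pi^{-1}(O)$ is open in $G$). Subsets such as $H$ carry the subspace topology. A space $(X,\tau)$ is $k$-semistratifiable if there is a function $S:\mathbb N\times\tau\to\{\text{closed subsets of }X\}$ such that (a) $U=\bigcup_{n=1}^\infty S(n,U)$ for each $U\in\tau$; (b) if $U,V\in\tau$ and $U\subset V$ then $S(n,U)\subset S(n,V)$ for each $n\in\mathbb N$; (c) for each $U\in\tau$ and each compact $K\subset U$ there is $n\in\mathbb N$ with $K\subset \bigcup_{i\le n}S(i,U)$. (Replacing $S(n,U)$ by $\bigcup_{i\le n}S(i,U)$, one may equivalently require $K\subset S(n,U)$ in (c).) A space is locally $k$-semistratifiable if every point has a neighborhood which, as a subspace, is $k$-semistratifiable. *)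

(* Defs.v *)
From HB Require Import structures.
From mathcomp Require Import all_boot all_order all_algebra.
From mathcomp Require Import all_classical all_reals.
From mathcomp Require Import topology.

Set Implicit Arguments.
Unset Strict Implicit.
Unset Printing Implicit Defensive.

Local Open Scope classical_set_scope.

Declare Scope gyro_scope.
Delimit Scope gyro_scope with gyro.
Reserved Notation "x ⊕ y" (at level 50, left associativity).
Reserved Notation "⊖ x" (at level 35, right associativity).

(* [gyr] is carried as data; the law [gaddA] determines it uniquely. *)
HB.mixin Record isGyrogroup (G : Type) := {
  gzero : G ;
  gopp : G -> G ;
  gadd : G -> G -> G ;
  gyr : G -> G -> G -> G ;
  gadd0x : forall a, gadd gzero a = a ;
  gaddx0 : forall a, gadd a gzero = a ;
  gzero_unique : forall e,
    (forall a, gadd e a = a /\ gadd a e = a) -> e = gzero ;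
  gaddNx : forall x, gadd (gopp x) x = gzero ;
  gaddxN : forall x, gadd x (gopp x) = gzero ;
  gopp_unique : forall x y,
    gadd y x = gzero -> gadd x y = gzero -> y = gopp x ;
  gyr_bij : forall x y, bijective (gyr x y) ;
  gyrD : forall x y, {morph gyr x y : a b / gadd a b} ;
  gaddA : forall x y z, gadd x (gadd y z) = gadd (gadd x y) (gyr x y z) ;
  gyr_loop : forall x y, gyr (gadd x y) y = gyr x y
}.

#[short(type="gyrogroupType")]
HB.structure Definition Gyrogroup := { G of isGyrogroup G & Choice G }.

Notation "x ⊕ y" := (gadd x y) : gyro_scope.
Notation "⊖ x" := (gopp x) : gyro_scope.
Local Open Scope gyro_scope.

HB.mixin Record Topological_isTopologicalGyrogroup (G : Type)
    & Topological G & Gyrogroup G := {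
  gadd_continuous : continuous (fun xy : G * G => xy.1 ⊕ xy.2) ;
  gopp_continuous : continuous (gopp : G -> G)
}.

#[short(type="topologicalGyrogroupType")]
HB.structure Definition TopologicalGyrogroup :=
  { G of Topological G & Gyrogroup G & Topological_isTopologicalGyrogroup G }.

(* [B] need not consist of open sets. *)
Definition nbhs_base {T : topologicalType} (x : T) (B : set_system T) :=
  B `<=` nbhs x /\ forall V, nbhs x V -> exists2 W, B W & W `<=` V.

Definition strongly_topological {G : topologicalGyrogroupType}
    (B : set_system G) :=
  nbhs_base gzero B /\
  forall U, B U ->
    gopp @` U = U /\ forall x y : G, gyr x y @` U = U.

Definition set_gadd {G : gyrogroupType} (A B : set G) : set G :=
  [set a ⊕ b | a in A & b in B].

Definition subgyrogroup {G : gyrogroupType} (H : set G) :=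
  [/\ H !=set0, forall a, H a -> H (⊖ a)
    & forall a b, H a -> H b -> H (a ⊕ b)].

Definition admissible_subgyrogroup {G : topologicalGyrogroupType}
    (B : set_system G) (H : set G) :=
  subgyrogroup H /\
  exists U : nat -> set G,
    [/\ forall n, [/\ open (U n), U n gzero, gopp @` U n = U n & B (U n)],
        forall n, set_gadd (U n.+1) (set_gadd (U n.+1) (U n.+1)) `<=` U n
      & H = \bigcap_n U n].

Definition left_coset {G : gyrogroupType} (H : set G) (a : G) : set G :=
  [set a ⊕ h | h in H].

(* A point of [coset_space H] is a set of the form [a ⊕ H]; the quotient
   topology below is final for [coset_proj], so it makes sense for every [H],
   whether or not the cosets are pairwise disjoint. *)
Definition coset_space {G : gyrogroupType} (H : set G) : Type :=
  set_type (range (left_coset H)).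

Definition coset_proj {G : gyrogroupType} (H : set G) (a : G) :
    coset_space H :=
  SigSub (mem_set (imageT (left_coset H) a)).

Section coset_topology.
Context {G : topologicalGyrogroupType} (H : set G).

HB.instance Definition _ :=
  Choice.copy (coset_space H) (set_type (range (left_coset H))).

Definition coset_open (O : set (coset_space H)) : Prop :=
  open (coset_proj H @^-1` O).

Let coset_openT : coset_open setT.
Proof. by rewrite /coset_open preimage_setT; exact: openT. Qed.

Let coset_openI (A B : set (coset_space H)) :
  coset_open A -> coset_open B -> coset_open (A `&` B).
Proof. exact: openI. Qed.

Let coset_open_bigU (I : Type) (f : I -> set (coset_space H)) :
  (forall i, coset_open (f i)) -> coset_open (\bigcup_i f i).
Proof. by move=> of_; apply: bigcup_open => i _; exact: of_. Qed.

HB.instance Definition _ := isOpenTopological.Build (coset_space H)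
  coset_openT coset_openI coset_open_bigU.

End coset_topology.

Definition metrizable (R : realType) (T : topologicalType) :=
  exists d : T -> T -> R,
    [/\ forall x y, (d x y = 0 <-> x = y)%R,
        forall x y, d x y = d y x,
        forall x y z, (d x z <= d x y + d y z)%R
      & forall (x : T) (A : set T),
          nbhs x A <-> exists2 e : R, (0 < e)%R & [set y | (d x y < e)%R] `<=` A].

(* The sequence [S n] is indexed from 0 rather than from 1. *)
Definition k_semistratifiable (T : topologicalType) :=
  exists S : nat -> set T -> set T,
    [/\ forall n U, open U -> closed (S n U),
        forall U, open U -> U = \bigcup_n S n U,
        forall n U V, open U -> open V -> U `<=` V -> S n U `<=` S n V
      & forall U K, open U -> compact K -> K `<=` U ->
          exists n, K `<=` \bigcup_(i < n.+1) S i U].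

Definition locally_k_semistratifiable (T : topologicalType) :=
  forall x : T, exists2 V : set T, nbhs x V & k_semistratifiable (set_type V).

(* Main.v *)
(* Since [H] is metrizable and is the intersection of the [U_n], the point 0 is
   a G_delta of [G], and invariance of the base under gyrations yields [W_n] in
   the base with [W_(n+1) ⊕ W_(n+1) ⊂ W_n] and intersection {0}; the left
   translates [x ⊕ W_n] behave like balls of a coarser metric. Since [H] is
   locally compact, every point has a closed neighbourhood [V] on which the
   projection [f] to [G/H] is a perfect map. If [S], increasing in [n],
   k-semistratifies [G/H], then [V] is k-semistratified by sending [(n, U)] to
   the closure of the set of all [x] with [f x] in [S n (O n x U)], where
   [O n x U] is the complement of the image of the part of the closure of
   [x ⊕ W_n] outside [U]. *)
Require Import Defs.
From mathcomp Require Import all_boot all_order all_algebra.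
From mathcomp Require Import all_classical all_reals.
From mathcomp Require Import topology.

Local Open Scope classical_set_scope.
Local Open Scope gyro_scope.

Lemma closed_nbhs_regular {T : topologicalType} (x : T) (A : set T) :
  regular_space T -> nbhs x A -> exists F, [/\ nbhs x F, closed F & F `<=` A].
Proof.
move=> regT /regT[F xF FA]; exists (closure F); split => //.
- by apply: filterS xF; exact: subset_closure.
- exact: closed_closure.
Qed.

(** * Preimages of k-semistratifiable spaces under perfect maps *)

Section perfect_preimage.
Context {X Y : topologicalType} (f : X -> Y) (N : nat -> X -> set X).
Hypothesis X_regular : regular_space X.
Hypothesis f_cont : continuous f.
Hypothesis f_closed : forall C, closed C -> closed (f @` C).
Hypothesis f_fiber : forall y, compact (f @^-1` [set y]).
(** The sets [N m x] act as balls shrinking with [m]: [N_sub] is a triangle inequality and [N_nbhsr]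
    stands in for symmetry. *)
Hypothesis N_nbhs : forall m x, nbhs x (N m x).
Hypothesis N_nbhsr : forall m x, \forall z \near x, N m z x.
Hypothesis N_sub : forall m x z, N m.+1 x z -> N m.+1 z `<=` N m x.
Hypothesis N_sep : forall x y, (forall m, N m x y) -> y = x.

Let N_refl m x : N m x x. Proof. exact: nbhs_singleton. Qed.

Let N_decr m n x : (m <= n)%N -> N n x `<=` N m x.
Proof.
move=> /subnK <-; elim: (n - m)%N => // k IH.
by apply: subset_trans IH; exact: N_sub.
Qed.

Let closure_N m x : closure (N m.+1 x) `<=` N m x.
Proof.
move=> y /(_ _ (N_nbhsr m.+1 y))[z [xz zy]].
exact: (N_sub _ _ _ xz).
Qed.

(* [f x] lies in the open set [O m x U] iff the part of the fibre of [x] in the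
   closed ball [closure (N m x)] is contained in [U]. *)
Let O m x U := ~` (f @` (closure (N m x) `\` U)).

Let open_O m x U : open U -> open (O m x U).
Proof.
move=> oU; apply/closed_openC/f_closed; rewrite setDE.
apply: closedI; first exact: closed_closure.
exact: open_closedC.
Qed.

Let O_shift m n x z U : (m < n)%N -> N m.+1 x z -> O m x U `<=` O n z U.
Proof.
move=> mn xz; apply: subsetC; apply: image_subset; apply: setSD.
apply: closureS; apply: subset_trans (N_sub _ _ _ xz).
exact: N_decr.
Qed.

(** The closed balls around [x] decrease to [x], so the part of the fibre outside [U], being
    compact, is missed by one of them. *)
Let O_fiber x U : open U -> U x -> exists m, O m x U (f x).
Proof.
move=> oU Ux; have /compact_near_coveringP cF :
    compact (f @^-1` [set f x] `&` ~` U).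
  by apply: compact_closedI; [exact: f_fiber|exact: open_closedC].
have [|m _ /(_ m (leqnn m)) mF] :=
    cF nat \oo (fun m y => ~ closure (N m x) y) _.
  move=> y [_ /= Uy].
  have [m xmy] : exists m, ~ closure (N m x) y.
    apply: contrapT => /forallNP Nxy; apply: Uy.
    rewrite (N_sep x y) // => m; apply: closure_N.
    exact: contrapT (Nxy m.+1).
  exists (~` closure (N m x), [set n | (m <= n)%N]).
    split => /=; last exact: nbhs_infty_ge.
    apply: open_nbhs_nbhs; split => //.
    exact/closed_openC/closed_closure.
  move=> [z n] [/= xmz mn] /closureS; apply: contra_not xmz.
  by move=> /(_ _ (N_decr _ _ _ mn)).
by exists m => -[y [cy Uy] fyx]; apply: (mF y).
Qed.

Theorem k_semistratifiable_perfect_preimage :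
  k_semistratifiable Y -> k_semistratifiable X.
Proof.
move=> [S [S_closed S_cup S_mono S_compact]].
(* Partial unions make the operator increasing in [n]. *)
pose S' n V := \bigcup_(i < n.+1) S i V.
have S'_closed n V : open V -> closed (S' n V).
  move=> oV; rewrite /S'; apply: closed_bigcup => // i _; exact: S_closed.
have S'_mono m n V W : open V -> open W -> (m <= n)%N -> V `<=` W ->
    S' m V `<=` S' n W.
  move=> oV oW mn VW y [i im Viy]; exists i; first exact: leq_trans im _.
  exact: S_mono Viy.
have S'_sub n V : open V -> S' n V `<=` V.
  by move=> oV y [i _ Viy]; rewrite (S_cup V oV); exists i.
pose D n U := [set z | S' n (O n z U) (f z)].
have D_sub n U : open U -> closure (D n U) `<=` U.
  move=> oU z cz.
  have Sz : S' n.+1 (O n.+1 z U) (f z).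
    have cS : closed (f @^-1` S' n.+1 (O n.+1 z U)).
      apply: preimage_closed => [? _|]; [exact: f_cont|exact/S'_closed/open_O].
    apply: cS => A zA.
    (* For [x] in [D n U] near [z], the point [z] lies in [N n.+1 x], hence [O n x U] is inside
       [O n.+1 z U]; the index rises by one to pay for moving the centre. *)
    have [x [Dx [xz Ax]]] := cz _ (filterI (N_nbhsr n.+1 z) zA).
    exists x; split => //.
    by apply: S'_mono Dx; [exact: open_O|exact: open_O|exact: leqnSn|exact: O_shift].
  apply: contrapT => Uz; apply: (S'_sub _ _ (open_O _ _ _ oU) _ Sz).
  by exists z => //; split => //; apply: subset_closure.
have D_compact U K : open U -> compact K -> K `<=` U ->
    exists n, K `<=` D n U.
  move=> oU cK KU.
  have /compact_near_coveringP/near_covering_withinP cK' := cK.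
  have [|n _ /(_ n (leqnn n)) nD] := cK' nat \oo (fun n z => D n U z) _.
    move=> x Kx; have [m Ox] := O_fiber _ _ oU (KU _ Kx).
    (* A closed [F] keeps [K] cut with [F] compact. Its image lies in the single open set [O m x U],
       and [O_shift] replaces this set by [O n z U] for all [z] in [F] at once. *)
    have [|F [xF cF FO]] := closed_nbhs_regular x
        (N m.+1 x `&` f @^-1` O m x U) X_regular.
      apply: filterI => //; apply: f_cont; apply: open_nbhs_nbhs.
      by split => //; exact: open_O.
    have cfKF : compact (f @` (K `&` F)).
      apply: continuous_compact; last exact: compact_closedI.
      exact: continuous_subspaceT.
    have [||n0 n0P] := S_compact (O m x U) _ _ cfKF.
    - exact: open_O.
    - by move=> _ [z [_ /FO[_ ?]] <-].
    exists (F, [set n | (maxn n0 m.+1 <= n)%N]).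
      by split => //=; exact: nbhs_infty_ge.
    move=> [z n] [/= Fz]; rewrite geq_max => /andP[n0n mn] Kz.
    apply: (S'_mono n0 n (O m x U)) => //.
    - exact: open_O.
    - exact: open_O.
    - by apply: O_shift => //; case: (FO _ Fz).
    - by apply: n0P; exists z.
  by exists n => z; exact: nD.
exists (fun n U => closure (D n U)); split.
- by move=> n U _; exact: closed_closure.
- move=> U oU; rewrite eqEsubset; split => [x Ux|x [n _ /D_sub]]; last exact.
  have [|n nD] := D_compact U [set x] oU (@compact_set1 _ x).
    by move=> _ ->.
  by exists n => //; apply: subset_closure; exact: nD.
- move=> n U V oU oV UV; apply: closureS => z.
  apply: S'_mono => //; [exact: open_O|exact: open_O|].
  apply: subsetC; apply: image_subset; exact: setDS.
- move=> U K oU cK KU; have [n nD] := D_compact U K oU cK KU.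
  by exists n => z /nD Dz; exists n => //=; exact: subset_closure.
Qed.

End perfect_preimage.

(** * Gyrogroup algebra *)

Section gyrogroup_theory.
Context {G : gyrogroupType}.
Implicit Types a b c x y z : G.

Lemma gyr_inj x y : injective (gyr x y).
Proof. exact: bij_inj (gyr_bij x y). Qed.

Lemma gaddI a : injective (gadd a).
Proof.
move=> b c abc; apply: (gyr_inj (⊖ a) a).
by rewrite -[LHS]gadd0x -[RHS]gadd0x -(gaddNx a) -!gaddA abc.
Qed.

Lemma gyr0x a b : gyr gzero a b = b.
Proof. by apply: (gaddI a); rewrite -[X in X ⊕ gyr _ _ _]gadd0x -gaddA gadd0x. Qed.

Lemma gyrx0 a b : gyr a gzero b = b.
Proof. by apply: (gaddI a); rewrite -[X in X ⊕ gyr _ _ _]gaddx0 -gaddA gadd0x. Qed.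

Lemma gyrNx a b : gyr (⊖ a) a b = b.
Proof. by rewrite -gyr_loop gaddNx gyr0x. Qed.

Lemma gyrxx a b : gyr a a b = b.
Proof. by rewrite -{1}(gadd0x a) gyr_loop gyr0x. Qed.

Lemma gaddKN a b : ⊖ a ⊕ (a ⊕ b) = b.
Proof. by rewrite gaddA gaddNx gadd0x gyrNx. Qed.

Lemma goppK a : ⊖ ⊖ a = a.
Proof. by apply/esym/gopp_unique; rewrite ?gaddNx ?gaddxN. Qed.

Lemma gaddNK a b : a ⊕ (⊖ a ⊕ b) = b.
Proof. by rewrite -{1}(goppK a) gaddKN. Qed.

Lemma gyrxN a b : gyr a (⊖ a) b = b.
Proof. by rewrite -{1}(goppK a) gyrNx. Qed.

Lemma gyr_0 a b : gyr a b gzero = gzero.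
Proof. by apply: (gaddI (a ⊕ b)); rewrite -gaddA !gaddx0. Qed.

Lemma gyr_opp a b x : gyr a b (⊖ x) = ⊖ gyr a b x.
Proof.
by apply: gopp_unique; rewrite -gyrD ?gaddNx ?gaddxN gyr_0.
Qed.

Lemma gyrE a b x : gyr a b x = ⊖ (a ⊕ b) ⊕ (a ⊕ (b ⊕ x)).
Proof. by rewrite [X in _ ⊕ X]gaddA gaddKN. Qed.

(* Both sides reassociate [a ⊕ (b ⊕ (c ⊕ x))]. *)
Lemma gyr_gyr a b c x :
  gyr a (b ⊕ c) (gyr b c x) = gyr (a ⊕ b) (gyr a b c) (gyr a b x).
Proof.
apply: (gaddI (a ⊕ (b ⊕ c))).
by rewrite -gaddA -gaddA [in RHS]gaddA -gaddA -gyrD -gaddA.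
Qed.

(** The loop property turns the outer gyration into one from [a ⊕ b]; then [gyr_gyr] with [c = ⊖ b]
    cancels everything. *)
Lemma gyrK a b x : gyr a (⊖ gyr a b b) (gyr a b x) = x.
Proof.
have ab_sub : (a ⊕ b) ⊕ ⊖ gyr a b b = a by rewrite -gyr_opp -gaddA gaddxN gaddx0.
rewrite -{1}ab_sub gyr_loop -gyr_opp -gyr_gyr.
by rewrite gaddxN gyrx0 gyrxN.
Qed.

(** Right division: [a ⊕ ⊖ gyr a b b] is the cosubtraction of gyrogroup theory. *)
Lemma gaddBK a b : (a ⊕ ⊖ gyr a b b) ⊕ b = a.
Proof. by rewrite -{3}(gyrK a b b) -gaddA gaddNx gaddx0. Qed.

End gyrogroup_theory.

(** * Transfer between a space and its subspaces *)

Section subspace.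
Context {T : topologicalType} {V : set T}.

Lemma set_val_continuous : continuous (set_val : set_type V -> T).
Proof. exact: initial_continuous. Qed.

Lemma nbhs_set_type {x : set_type V} {A : set (set_type V)} :
  nbhs x A -> exists2 C, nbhs (set_val x) C & set_val @^-1` C `<=` A.
Proof.
rewrite nbhsE => -[_ [[C oC <-] Cx] CA]; exists C => //.
by exists C.
Qed.

Lemma regular_set_type : regular_space T -> regular_space (set_type V).
Proof.
move=> regT x A /nbhs_set_type[C xC CA].
have [F [xF cF FC]] := closed_nbhs_regular _ _ regT xC.
exists (set_val @^-1` F); first exact: set_val_continuous.
have cF' : closed (set_val @^-1` F : set (set_type V)).
  by apply: preimage_closed cF => ? _; exact: set_val_continuous.
by rewrite -(iffLR (closure_id _) cF'); apply: subset_trans CA => y /FC.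
Qed.

Lemma compact_set_type (A : set (set_type V)) :
  compact (set_val @` A) -> compact A.
Proof.
move=> cA F PF FA.
have [_ [[x Ax <-] xF]] :
    (set_val @` A `&` cluster (set_val @ F)) !=set0.
  by apply: cA; apply: (@filterS _ F _ A) FA => y; exists y.
exists x; split => // C D FC /nbhs_set_type[E xE ED].
have FC' : (set_val @ F) (set_val @` C).
  by apply: (@filterS _ F _ C) FC => y; exists y.
have [_ [[y Cy <-] Ey]] := xF _ _ FC' xE.
by exists y; split => //; exact: ED.
Qed.

Lemma closed_image_set_val (A : set (set_type V)) :
  closed V -> closed A -> closed (set_val @` A).
Proof.
move=> cV cA x cx; have Vx : V x.
  apply: cV => C /cx[_ [[y Ay <-] Cy]].
  by exists (set_val y); split => //; exact: set_valP.
exists (SigSub (mem_set Vx)) => //; apply: cA => C /nbhs_set_type[D xD DC].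
have [_ [[y Ay <-] Dy]] := cx D xD.
by exists y; split => //; exact: DC.
Qed.

End subspace.

(** * Continuity of division *)

Section topological_gyrogroup.
Context {G : topologicalGyrogroupType}.

Lemma gadd_cvg {T : Type} {F : set_system T} {FF : Filter F} {f g : T -> G}
    {a b : G} :
  f @ F --> a -> g @ F --> b -> (fun t => f t ⊕ g t) @ F --> a ⊕ b.
Proof. exact: (continuous2_cvg FF (gadd_continuous (a, b))). Qed.

Lemma gopp_cvg {T : Type} {F : set_system T} {FF : Filter F} {f : T -> G}
    {a : G} :
  f @ F --> a -> (fun t => ⊖ f t) @ F --> ⊖ a.
Proof. by apply: continuous_cvg; exact: gopp_continuous. Qed.

Lemma nbhs_ldiv (x : G) (A : set G) :
  nbhs (gzero : G) A -> \forall y \near x, A (⊖ x ⊕ y).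
Proof.
rewrite -(gaddNx x) => A0.
exact: (gadd_cvg (cvg_cst (⊖ x)) cvg_id A A0).
Qed.

Lemma nbhs_ldivr (x : G) (A : set G) :
  nbhs (gzero : G) A -> \forall y \near x, A (⊖ y ⊕ x).
Proof.
rewrite -(gaddNx x) => A0.
exact: (gadd_cvg (gopp_cvg cvg_id) (cvg_cst x) A A0).
Qed.

Lemma nbhs_rdiv (x : G) (A : set G) :
  nbhs (gzero : G) A -> \forall y \near x, A (x ⊕ ⊖ gyr x y y).
Proof.
have -> : (gzero : G) = x ⊕ ⊖ gyr x x x by rewrite gyrxx gaddxN.
move=> A0; apply: (gadd_cvg (cvg_cst x) _ A A0); apply: gopp_cvg.
(* Continuity of [gyr x y y] in [y] comes from expressing [gyr] through [⊕] and [⊖]. *)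
under eq_fun do rewrite gyrE; rewrite gyrE.
apply: gadd_cvg; first by apply: gopp_cvg; apply: gadd_cvg; [exact: cvg_cst|].
by apply: gadd_cvg; [exact: cvg_cst|exact: gadd_cvg].
Qed.

(** Joint continuity at [(0, a, 0, a)], where the expression is [0]. When the trace of [A] on [H]
    lies in a compact [L], this confines to [L] the elements of [H] linking nearby points of one
    coset. *)
Lemma nbhs_gadd_box (a : G) (A : set G) :
  nbhs (gzero : G) A -> exists P C : set G,
    [/\ nbhs (gzero : G) P, nbhs a C &
      forall e c w d, P e -> C c -> P w -> C d -> A (⊖ ((e ⊕ c) ⊕ w) ⊕ d)].
Proof.
move=> nA; have A0 : nbhs (⊖ ((gzero ⊕ a) ⊕ gzero) ⊕ a) A.
  by rewrite gadd0x gaddx0 gaddNx.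
pose p0 : (G * G) * (G * G) := ((gzero, a), (gzero, a)).
have proj1 : fst @ nbhs p0 --> (gzero, a) by exact: cvg_fst.
have proj2 : snd @ nbhs p0 --> (gzero, a) by exact: cvg_snd.
have fst0 : fst @ nbhs ((gzero : G), a) --> (gzero : G) by exact: cvg_fst.
have snda : snd @ nbhs ((gzero : G), a) --> a by exact: cvg_snd.
have e_cvg := cvg_comp _ _ proj1 fst0.
have c_cvg := cvg_comp _ _ proj1 snda.
have w_cvg := cvg_comp _ _ proj2 fst0.
have d_cvg := cvg_comp _ _ proj2 snda.
have [[E F] [/= [[E1 E2] [/= nE1 nE2] EE] [[F1 F2] [/= nF1 nF2] FF]] EFA] :=
  gadd_cvg (gopp_cvg (gadd_cvg (gadd_cvg e_cvg c_cvg) w_cvg)) d_cvg A A0.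
exists (E1 `&` F1), (E2 `&` F2); split; [exact: filterI|exact: filterI|].
move=> e c w d [Ee _] [Ec _] [_ Fw] [_ Fd].
by apply: (EFA ((e, c), (w, d))); split; [exact: EE|exact: FF].
Qed.

End topological_gyrogroup.

(** * Cosets and the quotient projection *)

Section cosets.
Context {G : topologicalGyrogroupType} (H : set G).
Hypothesis H_sub : subgyrogroup H.
Hypothesis H_gyr : forall x y : G, gyr x y @` H = H.

Lemma left_cosetP (x y : G) : left_coset H x y <-> H (⊖ x ⊕ y).
Proof.
split; first by move=> [h Hh <-]; rewrite gaddKN.
by move=> Hxy; exists (⊖ x ⊕ y); rewrite ?gaddNK.
Qed.

Lemma left_coset_refl (x : G) : left_coset H x x.
Proof.
apply/left_cosetP; rewrite gaddNx; case: H_sub => -[h Hh] HN HD.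
by rewrite -(gaddNx h); apply: HD => //; exact: HN.
Qed.

Lemma left_coset_eq (x y : G) :
  left_coset H x y -> left_coset H y = left_coset H x.
Proof.
case: H_sub => _ HN HD [h Hh <-]; rewrite eqEsubset; split => _ [k Hk <-].
  have [k' Hk' <-] : (gyr x h @` H) k by rewrite H_gyr.
  by rewrite -gaddA; exists (h ⊕ k') => //; exact: HD.
exists (gyr x h (⊖ h ⊕ k)); last by rewrite -gaddA gaddNK.
by rewrite -(H_gyr x h); apply: imageP; apply: HD => //; exact: HN.
Qed.

Lemma left_coset_gadd (e c y : G) :
  left_coset H c y -> left_coset H (e ⊕ c) (e ⊕ y).
Proof.
move=> [h Hh <-]; rewrite gaddA; exists (gyr e c h) => //.
by rewrite -(H_gyr e c); exact: imageP.
Qed.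

Lemma coset_projP (x y : G) :
  coset_proj H x = coset_proj H y <-> left_coset H y x.
Proof.
split=> [/(congr1 set_val) /= xy|/left_coset_eq xy].
  rewrite -[left_coset H y]xy; exact: left_coset_refl.
exact: val_inj.
Qed.

Lemma coset_proj_continuous : continuous (coset_proj H).
Proof. by apply/continuousP. Qed.

(* For [x] in the closure of [C ⊕ H], right division gives a point [x1] of
   [P ⊕ C] in the coset of [x]; the points [y] of [C ⊕ H] near [x1] are then
   brought into [C] by right translations from the compact set [L]. *)
Lemma closed_saturation (L P V : set G) :
  compact L -> L `<=` H -> nbhs (gzero : G) P ->
  (forall e c w d, P e -> V c -> P w -> V d ->
     H (⊖ ((e ⊕ c) ⊕ w) ⊕ d) -> L (⊖ ((e ⊕ c) ⊕ w) ⊕ d)) ->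
  forall C, closed C -> C `<=` V ->
    closed [set y | exists2 c, C c & left_coset H c y].
Proof.
move=> cL LH nP PVL C cC CV x cx.
have [y0 [[c0 Cc0 c0y0]]] := cx _ (nbhs_rdiv x P nP).
set e := x ⊕ _ => Pe; have ey0 : e ⊕ y0 = x by exact: gaddBK.
pose x1 := e ⊕ c0.
have x1x : left_coset H x1 x by rewrite -ey0; exact: left_coset_gadd.
have [k0 Hk0 x1E] : left_coset H x x1.
  by rewrite (left_coset_eq _ _ x1x); exact: left_coset_refl.
(* Right translation by [k0] in [H] preserves the saturation of [C] and carries [x] to [x1]. *)
have cx1 : closure [set y | exists2 c, C c & left_coset H c y] x1.
  move=> A; rewrite -x1E => A1.
  have Ax : \forall y \near x, A (y ⊕ k0).
    exact: (gadd_cvg cvg_id (cvg_cst k0) A A1).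
  have [y [[c Cc cy] Ay]] := cx _ Ax.
  exists (y ⊕ k0); split => //; exists c => //.
  by rewrite -(left_coset_eq _ _ cy); exists k0.
have [k Lk Ck] : exists2 k, L k & C (x1 ⊕ k).
  apply: contrapT => /forall2NP nC.
  have /compact_near_coveringP/near_covering_withinP cL' := cL.
  have nU : \forall y \near x1, L `<=` (fun k => ~ C (y ⊕ k)).
    apply: cL' => k Lk; have [//|nCk] := nC k.
    have : \forall p \near (k, x1), (~` C) (p.2 ⊕ p.1).
      apply: (gadd_cvg cvg_snd cvg_fst).
      by apply: open_nbhs_nbhs; split => //; exact: closed_openC.
    by apply: filterS => p.
  have [y [[c Cc cy] [Py yP]]] := 
    cx1 _ (filterI (nbhs_ldiv x1 P nP) nU).
  have yc : H (⊖ y ⊕ c).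
    apply/left_cosetP; rewrite (left_coset_eq _ _ cy); exact: left_coset_refl.
  apply: (yP (⊖ y ⊕ c)); last by rewrite gaddNK.
  (* [PVL] is applied with [c := c0], [w := ⊖ x1 ⊕ y] and [d := c], so that [(e ⊕ c0) ⊕ w] is
     [y]. *)
  rewrite -(gaddNK x1 y); apply: PVL => //; [exact: CV|exact: CV|].
  by rewrite -/x1 gaddNK.
exists (x1 ⊕ k) => //.
rewrite (_ : left_coset H (x1 ⊕ k) = left_coset H x1) //.
by apply: left_coset_eq; exists k => //; exact: LH.
Qed.

(** With [e = w = 0] the hypothesis shows that the coset of a point [c] of [V] meets [V] only inside
    the compact set [c ⊕ L]. *)
Lemma compact_fiber (L P V : set G) :
  compact L -> L `<=` H -> nbhs (gzero : G) P -> closed V ->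
  (forall e c w d, P e -> V c -> P w -> V d ->
     H (⊖ ((e ⊕ c) ⊕ w) ⊕ d) -> L (⊖ ((e ⊕ c) ⊕ w) ⊕ d)) ->
  forall x, compact (left_coset H x `&` V).
Proof.
move=> cL LH nP cV PVL x.
have [[c [xc Vc]]|] := pselect ((left_coset H x `&` V) !=set0); last first.
  by move/set0P/negP; rewrite negbK => /eqP ->; exact: compact0.
rewrite -(left_coset_eq _ _ xc).
have -> : left_coset H c `&` V = (gadd c @` L) `&` V.
  rewrite eqEsubset; split => y [cy Vy]; split => //; last first.
    by case: cy => h /LH Hh <-; exists h.
  have P0 := nbhs_singleton nP.
  exists (⊖ c ⊕ y); last exact: gaddNK.
  have := PVL gzero c gzero y P0 Vc P0 Vy.
  by rewrite gadd0x gaddx0; apply; apply/left_cosetP.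
apply: compact_closedI => //; apply: continuous_compact => //.
apply: continuous_subspaceT => z.
exact: (gadd_cvg (cvg_cst c) cvg_id).
Qed.

(** By definition of the quotient topology, the image of [C] is closed as soon as the saturation of
    [C] is closed in [G]. *)
Lemma coset_proj_closed_map (L P V : set G) :
  compact L -> L `<=` H -> nbhs (gzero : G) P ->
  (forall e c w d, P e -> V c -> P w -> V d ->
     H (⊖ ((e ⊕ c) ⊕ w) ⊕ d) -> L (⊖ ((e ⊕ c) ⊕ w) ⊕ d)) ->
  forall C, closed C -> C `<=` V -> closed (coset_proj H @` C).
Proof.
move=> cL LH nP PVL C cC CV; rewrite -[X in closed X]setCK.
apply: open_closedC; suff : open (coset_proj H @^-1` (~` (coset_proj H @` C))).
  by [].
have -> : coset_proj H @^-1` (~` (coset_proj H @` C)) =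
    ~` [set y | exists2 c, C c & left_coset H c y].
  rewrite eqEsubset; split => y ny [c Cc cy]; apply: ny; exists c => //.
    exact/esym/coset_projP.
  exact/coset_projP/esym.
apply: closed_openC; exact: closed_saturation PVL _ cC CV.
Qed.

End cosets.

(** * Consequences of a gyration-invariant base *)

Section strongly_topological.
Context {G : topologicalGyrogroupType} (B : set_system G).
Hypothesis B_strong : strongly_topological B.

Lemma base_nbhs (W : set G) : B W -> nbhs (gzero : G) W.
Proof. by case: B_strong => -[BN _] _ /BN. Qed.

Lemma base_half (A : set G) : nbhs (gzero : G) A ->
  exists2 W, B W & forall u v, W u -> W v -> A (u ⊕ v).
Proof.
rewrite -{1}(gadd0x (gzero : G)) => A0.
have [[C D] [/= nC nD] CDA] := gadd_continuous (gzero, gzero) A A0.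
case: B_strong => -[_ /(_ _ (filterI nC nD))[W BW WCD]] _.
by exists W => // u v /WCD[Cu _] /WCD[_ Dv]; exact: (CDA (u, v)).
Qed.

(* [⊖ x ⊕ y = u ⊕ v] with [u = ⊖ x ⊕ z] and [gyr x u v = ⊖ z ⊕ y]. *)
Lemma base_ldiv_trans (A W : set G) : B W ->
  (forall u v, W u -> W v -> A (u ⊕ v)) ->
  forall x y z, W (⊖ x ⊕ z) -> W (⊖ z ⊕ y) -> A (⊖ x ⊕ y).
Proof.
move=> BW WA x y z xz; have [_ /(_ W BW)[_ Wgyr]] := B_strong.
rewrite -{1}(Wgyr x (⊖ x ⊕ z)) => -[v Wv vE].
rewrite -(gaddNK z y) -vE -{1}(gaddNK x z) -gaddA gaddKN.
exact: WA.
Qed.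

(** If sums of two elements of [W] stay in the neighbourhood [A] translated to [0], the closure of
    [a ⊕ W] stays in [A]. *)
Lemma strongly_topological_regular : regular_space G.
Proof.
move=> a A aA.
have A0 : nbhs (gzero : G) [set u | A (a ⊕ u)].
  by apply: (gadd_cvg (cvg_cst a) cvg_id); rewrite gaddx0.
have [W BW WA] := base_half _ A0; have nW := base_nbhs _ BW.
exists [set y | W (⊖ a ⊕ y)]; first exact: nbhs_ldiv.
move=> y /(_ _ (nbhs_ldivr y W nW))[z [az zy]].
by rewrite -(gaddNK a y); exact: (base_ldiv_trans _ _ BW WA _ _ _ az zy).
Qed.

Lemma base_sequence (V : nat -> set G) :
  (forall n, nbhs (gzero : G) (V n)) ->
  exists W : nat -> set G,
    [/\ forall n, B (W n), forall n, W n `<=` V n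
      & forall n u v, W n.+1 u -> W n.+1 v -> W n (u ⊕ v)].
Proof.
move=> V0.
have /choice[g gP] : forall p : nat * set G, exists W, nbhs (gzero : G) p.2 ->
    [/\ B W, W `<=` V p.1 & forall u v, W u -> W v -> p.2 (u ⊕ v)].
  move=> [n A] /=; have [A0|nA0] := pselect (nbhs (gzero : G) A); last first.
    (* Dummy value: the recursion only meets neighbourhoods of [0]. *)
    by exists set0 => /nA0.
  have [W BW WA] := base_half _ A0.
  have [[_ /(_ _ (filterI (base_nbhs _ BW) (V0 n)))[W' BW' W'WV]] _] := B_strong.
  exists W' => _; split => // [u /W'WV[]//|u v /W'WV[Wu _] /W'WV[Wv _]].
  exact: WA.
(* Starting from [setT] leaves [W 0] constrained only by [B] and [V 0]. *)
pose W := fix W n := if n is m.+1 then g (n, W m) else g (0, setT).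
have W_B n : B (W n).
  elim: n => [|n IH]; first by case: (gP (0, setT) filterT).
  by case: (gP (n.+1, W n) (base_nbhs _ IH)).
exists W; split => // n; last first.
  by case: (gP (n.+1, W n) (base_nbhs _ (W_B n))).
case: n => [|n]; first by case: (gP (0, setT) filterT).
by case: (gP (n.+1, W n) (base_nbhs _ (W_B n))).
Qed.

(** Each [U n] belongs to [B] and is invariant; bijectivity of the gyration carries this over to the
    intersection. *)
Lemma admissible_gyr (H : set G) :
  admissible_subgyrogroup B H -> forall x y : G, gyr x y @` H = H.
Proof.
move=> [_ [U [U_nbhs _ ->]]] x y.
have gyrU n : gyr x y @` U n = U n.
  by have [_ _ _ BU] := U_nbhs n; have [_ /(_ _ BU)[_]] := B_strong.
rewrite eqEsubset; split => [_ [u Uu <-] n _|u Uu].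
  by rewrite -gyrU; apply: imageP; exact: Uu.
have [g gyrK' gyrK''] := gyr_bij x y.
exists (g u) => // n _; have := Uu n I; rewrite -{1}gyrU => -[v Uv <-].
by rewrite gyrK'.
Qed.

End strongly_topological.

(** * Metrizable and locally compact subspaces *)

(** The trace of [V n] on [H] lies in the ball of radius [1/(n+1)] around [z]. *)
Lemma metrizable_point_G_delta (R : realType) {T : topologicalType} (H : set T)
    (z : set_type H) : metrizable R (set_type H) ->
  exists V : nat -> set T, (forall n, nbhs (set_val z) (V n)) /\
    forall y, H y -> (forall n, V n y) -> y = set_val z.
Proof.
move=> [d [d0 dC d_triangle d_nbhs]].
have /choice[V VP] : forall n : nat, exists V : set T, nbhs (set_val z) V /\
    set_val @^-1` V `<=` [set y | (d z y < n.+1%:R^-1)%R].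
  move=> n; have : nbhs z [set y | (d z y < n.+1%:R^-1)%R].
    by apply/d_nbhs; exists n.+1%:R^-1%R => //; rewrite Num.Theory.invr_gt0.
  by move=> /nbhs_set_type[V zV VA]; exists V.
exists V; split => [n|y Hy Vy]; first by case: (VP n).
suff : z = SigSub (mem_set Hy) by move=> ->.
apply/d0/eqP; rewrite Order.POrderTheory.eq_le; apply/andP; split.
  rewrite Order.TotalTheory.leNgt; apply/negP => /ltr_add_invr[n].
  rewrite GRing.add0r => /(Order.POrderTheory.lt_trans _).
  have [_ /(_ (SigSub (mem_set Hy)) (Vy n)) /= dn] := VP n.
  by move=> /(_ _ dn); rewrite Order.POrderTheory.ltxx.
(* Nonnegativity of [d] follows from [0 = d z z <= 2 d z y]. *)
have := d_triangle z (SigSub (mem_set Hy)) z.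
rewrite (dC _ z) (d0 z z).2 // -GRing.mulr2n.
by rewrite Num.Theory.pmulrn_lge0.
Qed.

Lemma locally_compact_set_type {T : topologicalType} (H : set T) (x : T) :
  locally_compact [set: set_type H] -> H x ->
  exists L A, [/\ compact L, L `<=` H, nbhs x A & A `&` H `<=` L].
Proof.
move=> Hlc Hx; pose z : set_type H := SigSub (mem_set Hx).
have [K zK [cK _]] := Hlc z I.
have {}zK : nbhs z K by move: zK; rewrite within_interior // interiorT.
have [A xA AK] := nbhs_set_type zK.
exists (set_val @` K), A; split => //.
- apply: continuous_compact => //; apply: continuous_subspaceT.
  exact: set_val_continuous.
- by move=> _ [y _ <-]; exact: set_valP.
- move=> y [Ay Hy]; exists (SigSub (mem_set Hy)) => //.
  exact: AK.
Qed.

(** * Perfectness of the projection near each point *)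

Theorem corollary4p15 (R : realType) (G : topologicalGyrogroupType)
    (B : set_system G) (H : set G)
    (G_hausdorff : hausdorff_space G)
    (G_strong : strongly_topological B)
    (H_admissible : admissible_subgyrogroup B H)
    (H_locally_compact : locally_compact [set: set_type H])
    (H_metrizable : metrizable R (set_type H))
    (GH_k_semistratifiable : k_semistratifiable (coset_space H)) :
  locally_k_semistratifiable G.
Proof.
have H_sub : subgyrogroup H by case: H_admissible.
have H_gyr := admissible_gyr _ G_strong _ H_admissible.
have [_ [U [U_nbhs _ HE]]] := H_admissible.
have H0 : H gzero by rewrite HE => n _; case: (U_nbhs n).
have [V [V0 V_sep]] :=
  metrizable_point_G_delta R H (SigSub (mem_set H0)) H_metrizable.
(* The [U n] force the intersection of the [W n] into [H], where the [V n] isolate [0]. *)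
have [|W [WB WVU W_half]] := base_sequence _ G_strong (fun n => V n `&` U n).
  move=> n; apply: filterI; first exact: V0.
  by have [oU U0 _ _] := U_nbhs n; exact: open_nbhs_nbhs.
have W0 n : nbhs (gzero : G) (W n) := base_nbhs _ G_strong _ (WB n).
have W_sep u : (forall n, W n u) -> u = gzero.
  move=> Wu; apply: V_sep => [|n]; last by case: (WVU _ _ (Wu n)).
  by rewrite HE => n _; case: (WVU _ _ (Wu n)).
have [L [A [cL LH nA ALH]]] := locally_compact_set_type H _ H_locally_compact H0.
have regG := strongly_topological_regular _ G_strong.
move=> a.
have [P [C [P0 aC PCL]]] := nbhs_gadd_box a A nA.
(* [D] must be closed for the inclusion of [D] to preserve closed sets and for fibres in [D] to be
   compact. *)
have [D [aD cD DC]] := closed_nbhs_regular _ _ regG aC.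
have PDL e c w d : P e -> D c -> P w -> D d ->
    H (⊖ ((e ⊕ c) ⊕ w) ⊕ d) -> L (⊖ ((e ⊕ c) ⊕ w) ⊕ d).
  move=> Pe Dc Pw Dd Hd; apply: ALH; split => //.
  by apply: PCL => //; exact: DC.
exists D => //.
apply: (@k_semistratifiable_perfect_preimage _ _
  (fun x : set_type D => coset_proj H (set_val x))
  (fun n x y => W n (⊖ set_val x ⊕ set_val y))) => //.
- exact: regular_set_type.
- move=> x; apply: continuous_comp; first exact: set_val_continuous.
  exact: coset_proj_continuous.
- move=> K cK.
  rewrite (_ : _ @` K = coset_proj H @` (set_val @` K)); last first.
    by rewrite image_comp.
  apply: (coset_proj_closed_map _ H_sub H_gyr _ _ _ cL LH P0 PDL).
    exact: closed_image_set_val.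
  by move=> _ [y _ <-]; exact: set_valP.
- move=> q; apply: compact_set_type.
  have [x _ xq] := set_valP q.
  have {xq} -> : q = coset_proj H x by exact/val_inj/esym.
  rewrite (_ : set_val @` _ = left_coset H x `&` D).
    exact: (compact_fiber _ H_sub H_gyr _ _ _ cL LH P0 cD PDL).
  rewrite eqEsubset; split => [_ [y yx <-]|y [xy Dy]].
    by split; [exact/(coset_projP _ H_sub H_gyr)|exact: set_valP].
  by exists (SigSub (mem_set Dy)) => //; exact/(coset_projP _ H_sub H_gyr).
- move=> m x; exact: (set_val_continuous _ _ (nbhs_ldiv _ _ (W0 m))).
- move=> m x; exact: (set_val_continuous _ _ (nbhs_ldivr _ _ (W0 m))).
- move=> m x z xz y zy.
  exact: (base_ldiv_trans _ G_strong _ _ (WB m.+1) (W_half m) _ _ _ xz zy).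
- move=> x y /W_sep xy; apply: val_inj.
  by rewrite -[RHS]gaddx0 -xy gaddNK.
Qed.
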